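(* Let $k\in\{1,2\}$, $p_0\in\mathbb{R}$, $\alpha>-1$, $\beta\in\mathbb{R}$ and $\xi_s>0$. Let $$r=|t|^{\alpha+1}\xi,\quad \rho=|t|^{\beta}R(\xi),\quad u=|t|^{\alpha}V(\xi),\quad p-p_0=|t|^{2\alpha+\beta}\Pi(\xi)\qquad(t<0,\ \xi\ge\xi_s)$$ be a self-similar solution of the Euler system (E) of the context in the region behind a converging jump located at $r_s(t)=\xi_s|t|^{\alpha+1}$, where $R>0$ and $R,V,\Pi$ are continuously differentiable on $[\xi_s,\infty)$. Assume that: (i) (boundedness) for each $t<0$, the quantities $\rho,u,p$ and the sound speed $c$ remain bounded as $r\to\infty$; (ii) (entropy condition) immediately behind the jump, i.e. at $\xi=\xi_s$, the jump is subsonic relative to the fluid: $|u_s-u|<c$, where $u_s=\frac{dr_s}{dt}$. Put $X(\xi)=(\alpha+1)\xi+V(\xi)$ and let $C(\xi)\ge 0$ be the scaled sound speed, $c=|t|^{\alpha}C(\xi)$. Then there exists $\xi_*>\xi_s$ with $X(\xi_* )^2=C(\xi_* )^2$. In particular, the denominator $R X(X^2-C^2)$ in the explicit ODE form (O) of the context vanishes at some point behind the jump.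
   Context: The Euler system (E), for functions $\rho>0$, $u$, $p$ of $(r,t)$ with $r>0$, is $$\rho_t+u\rho_r+\rho\Big(u_r+\frac{ku}{r}\Big)=0,\qquad u_t+uu_r+\frac1\rho p_r=0,\qquad p_t+up_r+K_S(p,\rho)\Big(u_r+\frac{ku}{r}\Big)=0,$$ where $k=1$ (cylindrical) or $k=2$ (spherical symmetry), and the adiabatic bulk modulus $K_S$ is a given nonnegative smooth function of $(p,\rho)$ on a set containing all values attained by the solution. The sound speed $c\ge0$ is defined by $K_S=\rho c^2$. It is assumed that $K_S$ is compatible with the scaling, i.e. $$\beta\rho\frac{\partial K_S}{\partial\rho}+(2\alpha+\beta)(p-p_0)\frac{\partial K_S}{\partial p}=(2\alpha+\beta)K_S,$$ so that along the self-similar solution $C=|t|^{-\alpha}c$ is a function of $\xi$ alone. For such self-similar solutions, (E) is equivalent, wherever $X(X^2-C^2)\neq0$, to the explicit ODE system (O): $$\frac{d}{d\xi}\begin{pmatrix} R \\ V \\ \Pi \end{pmatrix}=\frac{(\beta+2\alpha)\Pi-R V\left(\alpha X+k\frac{C^2}{\xi}\right)}{R X(X^2-C^2)}\begin{pmatrix} R \\ -X \\ R X^2 \end{pmatrix}+\begin{pmatrix} \left(\beta-k\frac{V}{\xi}\right)\frac{R}{X} \\ 0 \\ \alpha R V \end{pmatrix}.$$ *)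

(* Defs.v *)
From Stdlib Require Import Reals.
From Coquelicot Require Import Coquelicot.
Open Scope R_scope.

(* Flow variables are functions of (r, t), in this order; the bulk modulus KS
   is a function of (p, rho), in this order.  All of them are total functions,
   constrained only where the flow lives. *)

(* Continuous differentiability on [a, +oo), the derivative at a being
   one-sided. *)
Definition C1_from (a : R) (f : R -> R) : Prop :=
  exists f' : R -> R,
    forall x, a <= x ->
      filterdiff f (within (Rle a) (locally x)) (fun h => scal h (f' x)) /\
      filterlim f' (within (Rle a) (locally x)) (locally (f' x)).

(* As usual for a set D that need not be open, smoothness on D means being
   C^oo on an open neighbourhood of D. *)
Definition smooth_on (D : R -> R -> Prop) (f : R -> R -> R) : Prop :=
  exists U : R -> R -> Prop,
    (forall x y, U x y -> locally_2d U x y) /\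
    (forall x y, D x y -> U x y) /\
    (forall x y, U x y -> forall n : nat, ex_diff_n f n x y).

Definition scaling_compatible (alpha beta p0 : R) (D : R -> R -> Prop)
    (KS : R -> R -> R) : Prop :=
  forall p rho, D p rho ->
    beta * rho * Derive (fun s => KS p s) rho
      + (2 * alpha + beta) * (p - p0) * Derive (fun s => KS s rho) p
    = (2 * alpha + beta) * KS p rho.

Definition euler_at (k : nat) (KS : R -> R -> R) (rho u p : R -> R -> R)
    (r t : R) : Prop :=
  exists rho_r rho_t u_r u_t p_r p_t : R,
    is_derive (fun s => rho s t) r rho_r /\
    is_derive (fun s => rho r s) t rho_t /\
    is_derive (fun s => u s t) r u_r /\
    is_derive (fun s => u r s) t u_t /\
    is_derive (fun s => p s t) r p_r /\
    is_derive (fun s => p r s) t p_t /\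
    rho_t + u r t * rho_r
      + rho r t * (u_r + INR k * u r t / r) = 0 /\
    u_t + u r t * u_r + / rho r t * p_r = 0 /\
    p_t + u r t * p_r
      + KS (p r t) (rho r t) * (u_r + INR k * u r t / r) = 0.

Definition radius (alpha xi t : R) : R := Rpower (Rabs t) (alpha + 1) * xi.

Definition self_similar (alpha beta p0 xi_s : R)
    (rho u p : R -> R -> R) (Rh V Pi : R -> R) : Prop :=
  forall t xi, t < 0 -> xi_s <= xi ->
    rho (radius alpha xi t) t = Rpower (Rabs t) beta * Rh xi /\
    u (radius alpha xi t) t = Rpower (Rabs t) alpha * V xi /\
    p (radius alpha xi t) t - p0
      = Rpower (Rabs t) (2 * alpha + beta) * Pi xi.

Definition is_sound_speed (alpha xi_s : R) (KS : R -> R -> R)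
    (rho p c : R -> R -> R) : Prop :=
  forall r t, t < 0 -> radius alpha xi_s t <= r ->
    0 <= c r t /\ KS (p r t) (rho r t) = rho r t * c r t ^ 2.

Definition is_scaled_sound_speed (alpha xi_s : R) (c : R -> R -> R)
    (Cs : R -> R) : Prop :=
  forall t xi, t < 0 -> xi_s <= xi ->
    0 <= Cs xi /\ c (radius alpha xi t) t = Rpower (Rabs t) alpha * Cs xi.

Definition bounded_at_infty (f : R -> R) : Prop :=
  exists M : R, Rbar_locally p_infty (fun r => Rabs (f r) <= M).

Definition scaled_X (alpha : R) (V : R -> R) (xi : R) : R :=
  (alpha + 1) * xi + V xi.

(* Main.v *)
(* X and C, hence the function X^2 - C^2, are continuous on [xi_s, +oo).  At xi_s
   the entropy condition says that it is negative; far away it is positive, since V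
   and C are bounded by (i) while (alpha + 1) xi tends to infinity.  The
   intermediate value theorem gives the zero.  Compatibility of KS with the scaling
   is Euler's relation for homogeneity along the curves
   l |-> (p0 + l^(2 alpha + beta) P, l^beta S), so c scales as |t|^alpha. *)

Require Import Defs.
From Stdlib Require Import Reals Lra.
From Coquelicot Require Import Coquelicot.
Open Scope R_scope.

(** Total differentiability follows as soon as both partial derivatives exist at the point, one of
    them also exists nearby and is continuous at the point. Openness of [U] supplies the
    neighbourhood, and order [1] of [ex_diff_n] the rest. *)
Lemma smooth_on_differentiable D f x y :
  smooth_on D f -> D x y ->
  differentiable_pt_lim f x y
    (Derive (fun z => f z y) x) (Derive (fun z => f x z) y).
Proof.
  intros [U [Uopen [DU Udiff]]] Dxy.
  pose proof (DU _ _ Dxy) as Uxy.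
  apply filterdiff_differentiable_pt_lim.
  apply (is_derive_filterdiff f x y (fun u v => Derive (fun z => f z v) u)).
  - destruct (Uopen _ _ Uxy) as [d Hd].
    exists d; intros [u v] [Hu Hv].
    apply Derive_correct.
    destruct (Udiff u v (Hd u v Hu Hv) 1%nat) as [_ [H _]]; exact H.
  - destruct (Udiff x y Uxy 1%nat) as [_ [_ [H _]]].
    apply Derive_correct; exact H.
  - destruct (Udiff x y Uxy 1%nat) as [_ [_ [_ [[H _] _]]]].
    apply (continuity_2d_pt_filterlim (fun u v => Derive (fun z => f z v) u)).
    exact H.
Qed.

Lemma smooth_on_continuity_2d D f x y :
  smooth_on D f -> D x y -> continuity_2d_pt f x y.
Proof.
  intros [U [_ [DU Udiff]]] Dxy.
  exact (proj1 (Udiff x y (DU _ _ Dxy) 0%nat)).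
Qed.

(* Flattening f to the left of a makes it continuous on the whole line, as the
   intermediate value theorem of the library requires. *)
Lemma C1_from_continuous_Rmax a f :
  C1_from a f -> forall x, continuous (fun y => f (Rmax a y)) x.
Proof.
  intros [f' Hf] x.
  destruct (Hf (Rmax a x) (Rmax_l a x)) as [Hdiff _].
  assert (Hmax : continuous (fun y => Rmax a y) x).
  { apply continuous_ext with (fun y => (a + y + Rabs (a - y)) / 2).
    - intros y; unfold Rmax, Rabs.
      destruct (Rle_dec a y), (Rcase_abs (a - y)); lra.
    - unfold Rdiv. apply (continuous_mult (fun y => a + y + Rabs (a - y))).
      + apply (continuous_plus (fun y => a + y)).
        * apply (continuous_plus (fun _ => a)); [apply continuous_const | apply continuous_id].
        * apply (continuous_comp (fun y => a - y) Rabs); [| apply continuous_Rabs].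
          apply (continuous_minus (fun _ => a)); [apply continuous_const | apply continuous_id].
      + apply continuous_const. }
  unfold continuous.
  (* Since [Rmax a y] never drops below [a], it tends to [Rmax a x] inside the half-line, so the
     one-sided differentiability of [f] suffices. *)
  apply filterlim_comp with (within (Rle a) (locally (Rmax a x))).
  - intros P HP. unfold within in HP.
    generalize (Hmax _ HP); unfold filtermap; apply filter_imp.
    intros y Hy; apply Hy, Rmax_l.
  - apply (filterdiff_continuous_aux (K := R_AbsRing) (U := R_NormedModule)
             (V := R_NormedModule)).
    + eexists; exact Hdiff.
    + intros P HP; unfold within.
      apply filter_imp with (2 := HP); auto.
Qed.

(** Along the scaling curve, the quotient [g] of [KS] by the expected power of [l] has derivative
    zero by the compatibility relation, hence equals its value at [l = 1]. With [l = Rabs t], the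
    curve is the set of states met at fixed [xi]. *)
Lemma scaling_compatible_homogeneous alpha beta p0 D KS P S :
  smooth_on D KS -> scaling_compatible alpha beta p0 D KS ->
  (forall l, 0 < l ->
     D (p0 + Rpower l (2 * alpha + beta) * P) (Rpower l beta * S)) ->
  forall l, 0 < l ->
    KS (p0 + Rpower l (2 * alpha + beta) * P) (Rpower l beta * S)
    = Rpower l (2 * alpha + beta) * KS (p0 + P) S.
Proof.
  intros Hsm Hsc HD.
  set (a := 2 * alpha + beta) in *.
  assert (Hpow : forall x y, 0 < x -> x * Rpower x (y - 1) = Rpower x y).
  { intros x y Hx. rewrite <- (Rpower_1 x Hx) at 1.
    rewrite <- Rpower_plus. f_equal; ring. }
  set (g := fun l =>
    Rpower l (- a) * KS (p0 + Rpower l a * P) (Rpower l beta * S)).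
  assert (Hg : forall l, 0 < l -> is_derive g l 0).
  { intros l Hl.
    set (q := p0 + Rpower l a * P); set (s := Rpower l beta * S).
    set (kq := Derive (fun z => KS z s) q); set (ks := Derive (fun z => KS q z) s).
    pose proof (smooth_on_differentiable _ _ _ _ Hsm (HD l Hl)) as Hd.
    assert (Hlin : forall b y T, derivable_pt_lim (fun l => b + Rpower l y * T) l
                     (y * Rpower l (y - 1) * T)).
    { intros b y T.
      replace (y * Rpower l (y - 1) * T)
        with (0 + (y * Rpower l (y - 1) * T + Rpower l y * 0)) by ring.
      apply (derivable_pt_lim_plus (fun _ => b)); [apply derivable_pt_lim_const |].
      apply (derivable_pt_lim_mult (fun l => Rpower l y) (fun _ => T));
        [apply derivable_pt_lim_power, Hl | apply derivable_pt_lim_const]. }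
    assert (Hs : derivable_pt_lim (fun l => Rpower l beta * S) l
                   (beta * Rpower l (beta - 1) * S)).
    { apply is_derive_Reals.
      apply is_derive_ext with (fun l => 0 + Rpower l beta * S); [intros y; apply Rplus_0_l |].
      apply is_derive_Reals, Hlin. }
    pose proof (derivable_pt_lim_mult _ _ _ _ _
      (derivable_pt_lim_power l (- a) Hl)
      (derivable_pt_lim_comp_2d KS _ _ _ _ _ _ _ Hd (Hlin p0 a P) Hs)) as H.
    cbv beta in H; fold q s kq ks in H.
    apply is_derive_Reals.
    match type of H with derivable_pt_lim _ _ ?d => replace 0 with d end;
      [exact H |].
    (* Multiplying by [l] restores the exponents lowered by differentiation. The chain rule term
       then becomes the left side of the compatibility relation [E], and cancels the term coming
       from [Rpower l (- a)]. *)
    apply Rmult_eq_reg_l with l; [| lra].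
    replace (l * (- a * Rpower l (- a - 1) * KS q s
        + Rpower l (- a) * (kq * (a * Rpower l (a - 1) * P)
                            + ks * (beta * Rpower l (beta - 1) * S))))
      with (- a * (l * Rpower l (- a - 1)) * KS q s
        + Rpower l (- a) * (kq * (a * (l * Rpower l (a - 1)) * P)
                            + ks * (beta * (l * Rpower l (beta - 1)) * S))) by ring.
    rewrite !Hpow by exact Hl.
    pose proof (Hsc _ _ (HD l Hl)) as E.
    fold q s kq ks a in E.
    replace (kq * (a * Rpower l a * P) + ks * (beta * Rpower l beta * S))
      with (a * KS q s) by (rewrite <- E; unfold q, s; ring).
    ring. }
  assert (Hconst : forall x y, 0 < x -> x < y -> g x = g y).
  { intros x y Hx Hxy; apply eq_is_derive; [| exact Hxy].
    intros t Ht; apply Hg; lra. }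
  assert (Hg1 : g 1 = KS (p0 + P) S).
  { unfold g, Rpower; rewrite ln_1, !Rmult_0_r, exp_0, !Rmult_1_l; reflexivity. }
  intros l Hl.
  assert (E : g l = g 1).
  { destruct (Rtotal_order l 1) as [H | [H | H]];
      [apply Hconst; lra | now rewrite H | symmetry; apply Hconst; lra]. }
  rewrite <- Hg1, <- E; unfold g.
  rewrite <- Rmult_assoc, <- Rpower_plus, Rplus_opp_r, Rpower_O by exact Hl.
  ring.
Qed.

Theorem mainTheorem2
  (k : nat) (p0 alpha beta xi_s : R)
  (D : R -> R -> Prop) (KS : R -> R -> R)
  (rho u p c : R -> R -> R) (Rh V Pi : R -> R)
  (hk : k = 1%nat \/ k = 2%nat)
  (halpha : -1 < alpha) (hxi_s : 0 < xi_s)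
  (hKS_smooth : smooth_on D KS)
  (hKS_nonneg : forall q s, D q s -> 0 <= KS q s)
  (hKS_scaling : scaling_compatible alpha beta p0 D KS)
  (hD : forall r t, t < 0 -> radius alpha xi_s t <= r -> D (p r t) (rho r t))
  (hRh_pos : forall xi, xi_s <= xi -> 0 < Rh xi)
  (hRh : C1_from xi_s Rh) (hV : C1_from xi_s V) (hPi : C1_from xi_s Pi)
  (hsim : self_similar alpha beta p0 xi_s rho u p Rh V Pi)
  (heuler : forall r t, t < 0 -> radius alpha xi_s t < r ->
     euler_at k KS rho u p r t)
  (hc : is_sound_speed alpha xi_s KS rho p c)
  (hbounded : forall t, t < 0 ->
     bounded_at_infty (fun r => rho r t) /\
     bounded_at_infty (fun r => u r t) /\
     bounded_at_infty (fun r => p r t) /\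
     bounded_at_infty (fun r => c r t))
  (hentropy : forall t, t < 0 ->
     Rabs (Derive (radius alpha xi_s) t - u (radius alpha xi_s t) t)
       < c (radius alpha xi_s t) t) :
  (exists Cs : R -> R, is_scaled_sound_speed alpha xi_s c Cs) /\
  (forall Cs : R -> R, is_scaled_sound_speed alpha xi_s c Cs ->
     exists xi : R, xi_s < xi /\
       scaled_X alpha V xi ^ 2 = Cs xi ^ 2 /\
       Rh xi * scaled_X alpha V xi * (scaled_X alpha V xi ^ 2 - Cs xi ^ 2) = 0).
Proof.
  (* At time [-1] every power of [Rabs t] is 1, so [r] coincides with [xi] and the profiles are the
     flow itself. All evaluations below use this time. *)
  assert (Hone : forall y, Rpower (Rabs (-1)) y = 1).
  { intros y; unfold Rpower; rewrite Rabs_left by lra.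
    replace (- -1) with 1 by lra.
    now rewrite ln_1, Rmult_0_r, exp_0. }
  assert (Hrad1 : forall xi, radius alpha xi (-1) = xi).
  { intros xi; unfold radius; rewrite Hone; ring. }
  assert (Hrad : forall xi t, xi_s <= xi -> radius alpha xi_s t <= radius alpha xi t).
  { intros xi t Hxi; apply Rmult_le_compat_l; [| exact Hxi].
    apply Rlt_le, exp_pos. }
  assert (Hp : forall t xi, t < 0 -> xi_s <= xi ->
    p (radius alpha xi t) t = p0 + Rpower (Rabs t) (2 * alpha + beta) * Pi xi).
  { intros t xi Ht Hxi; destruct (hsim t xi Ht Hxi) as [_ [_ H]]; lra. }
  assert (Hrho : forall t xi, t < 0 -> xi_s <= xi ->
    rho (radius alpha xi t) t = Rpower (Rabs t) beta * Rh xi).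
  { intros t xi Ht Hxi; apply (hsim t xi Ht Hxi). }
  assert (Hu1 : forall xi, xi_s <= xi -> u xi (-1) = V xi).
  { intros xi Hxi; destruct (hsim (-1) xi ltac:(lra) Hxi) as [_ [H _]].
    rewrite Hrad1, Hone in H; lra. }
  assert (Hc1 : forall xi, xi_s <= xi ->
    0 <= c xi (-1) /\ KS (p0 + Pi xi) (Rh xi) = Rh xi * c xi (-1) ^ 2).
  { intros xi Hxi.
    pose proof (hc xi (-1) ltac:(lra)) as H; rewrite Hrad1 in H.
    specialize (H Hxi).
    pose proof (Hp (-1) xi ltac:(lra) Hxi) as E.
    pose proof (Hrho (-1) xi ltac:(lra) Hxi) as E'.
    rewrite Hrad1, Hone, Rmult_1_l in E, E'.
    rewrite <- E, <- E'; exact H. }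
  assert (HD1 : forall xi, xi_s <= xi -> D (p0 + Pi xi) (Rh xi)).
  { intros xi Hxi.
    pose proof (hD xi (-1) ltac:(lra)) as H; rewrite Hrad1 in H.
    specialize (H Hxi).
    pose proof (Hp (-1) xi ltac:(lra) Hxi) as E.
    pose proof (Hrho (-1) xi ltac:(lra) Hxi) as E'.
    rewrite Hrad1, Hone, Rmult_1_l in E, E'.
    rewrite <- E, <- E'; exact H. }
  split.
  - exists (fun xi => c xi (-1)).
    intros t xi Ht Hxi.
    destruct (Hc1 xi Hxi) as [Hpos1 HK1].
    split; [exact Hpos1 |].
    assert (Hl : 0 < Rabs t) by (apply Rabs_pos_lt; lra).
    destruct (hc (radius alpha xi t) t Ht (Hrad xi t Hxi)) as [Hpos HK].
    rewrite Hp, Hrho in HK by assumption.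
    rewrite (scaling_compatible_homogeneous alpha beta p0 D KS (Pi xi) (Rh xi))
      in HK; try assumption.
    (* The point of the curve with parameter [l] is the flow state at time [- l], hence lies in
       [D]. *)
    2: { intros l Hl'.
         pose proof (hD (radius alpha xi (- l)) (- l) ltac:(lra) (Hrad xi _ Hxi)) as H.
         rewrite Hp, Hrho in H by (assumption || lra).
         rewrite Rabs_Ropp, Rabs_pos_eq in H by lra; exact H. }
    rewrite HK1 in HK.
    (* The factor with exponent [beta] belongs to the density; the two factors with exponent [alpha]
       form a square. Sound speeds being nonnegative, equality of squares is enough. *)
    replace (2 * alpha + beta) with (beta + (alpha + alpha)) in HK by ring.
    rewrite !Rpower_plus in HK.
    pose proof (exp_pos (beta * ln (Rabs t))) as Hb.
    pose proof (exp_pos (alpha * ln (Rabs t))) as Ha.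
    fold (Rpower (Rabs t) beta) in Hb; fold (Rpower (Rabs t) alpha) in Ha.
    pose proof (hRh_pos xi Hxi) as HR.
    apply Rsqr_inj; [exact Hpos | apply Rmult_le_pos; lra |].
    apply Rmult_eq_reg_l with (Rpower (Rabs t) beta * Rh xi);
      [unfold Rsqr; lra | apply Rmult_integral_contrapositive; lra].
  - intros Cs HCs.
    assert (HCc : forall xi, xi_s <= xi -> Cs xi = c xi (-1)).
    { intros xi Hxi; destruct (HCs (-1) xi ltac:(lra) Hxi) as [_ H].
      rewrite Hrad1, Hone in H; lra. }
    set (m := Rmax xi_s).
    (* The quotient of [KS] by [Rh] stands for the square of [Cs]: its continuity is inherited from
       the profiles and [KS], whereas [Cs] is arbitrary to the left of [xi_s]. *)
    set (f := fun x => scaled_X alpha V (m x) ^ 2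
                       - KS (p0 + Pi (m x)) (Rh (m x)) / Rh (m x)).
    assert (Hf : forall xi, xi_s <= xi ->
      f xi = scaled_X alpha V xi ^ 2 - Cs xi ^ 2).
    { intros xi Hxi; unfold f, m; rewrite (Rmax_right _ _ Hxi).
      destruct (Hc1 xi Hxi) as [_ HK].
      rewrite HK, (HCc xi Hxi).
      pose proof (hRh_pos xi Hxi); field; lra. }
    assert (Hcont : continuity f).
    { intros x; apply continuity_pt_filterlim.
      pose proof (C1_from_continuous_Rmax _ _ hRh x) as cR.
      pose proof (C1_from_continuous_Rmax _ _ hV x) as cV.
      pose proof (C1_from_continuous_Rmax _ _ hPi x) as cP.
      assert (Cid : C1_from xi_s (fun y => y)).
      { exists (fun _ => 1); intros y _; split; [| apply filterlim_const].
        apply filterdiff_ext_lin with (fun h => h); [apply filterdiff_id |].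
        intros h; symmetry; apply Rmult_1_r. }
      pose proof (C1_from_continuous_Rmax _ _ Cid x) as cm; cbv beta in cm.
      fold m in cR, cV, cP, cm.
      assert (Hm : xi_s <= m x) by apply Rmax_l.
      assert (cX : continuous (fun y => scaled_X alpha V (m y)) x).
      { apply (continuous_plus (fun y => (alpha + 1) * m y)); [| exact cV].
        apply (continuous_mult (fun _ => alpha + 1)); [apply continuous_const | exact cm]. }
      apply (continuous_minus (fun y => scaled_X alpha V (m y) ^ 2)).
      - apply continuous_ext with
          (fun y => scaled_X alpha V (m y) * scaled_X alpha V (m y));
          [intros y; simpl; now rewrite Rmult_1_r |].
        apply (continuous_mult _ _ _ cX cX).
      - apply (continuous_mult (fun y => KS (p0 + Pi (m y)) (Rh (m y)))).
        + apply (continuous_comp_2 (fun y => p0 + Pi (m y)) (fun y => Rh (m y)) KS).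
          * apply (continuous_plus (fun _ => p0)); [apply continuous_const | exact cP].
          * exact cR.
          * apply (continuity_2d_pt_filterlim KS).
            exact (smooth_on_continuity_2d _ _ _ _ hKS_smooth (HD1 _ Hm)).
        + apply (continuous_comp (fun y => Rh (m y)) Rinv); [exact cR |].
          apply continuous_Rinv, Rgt_not_eq, hRh_pos, Hm. }
    assert (Hneg : f xi_s < 0).
    { rewrite Hf by lra.
      pose proof (hentropy (-1) ltac:(lra)) as H.
      rewrite Hrad1, (Hu1 xi_s) in H by lra.
      rewrite <- (HCc xi_s) in H by lra.
      (* The jump moves inwards, so its velocity relative to the fluid is minus [scaled_X]. Within
         distance 1 of [-1], [t] stays negative and [Rabs t] is [- t]. *)
      assert (Hd : Derive (radius alpha xi_s) (-1) = - (alpha + 1) * xi_s).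
      { apply is_derive_unique.
        apply is_derive_ext_loc with (fun t => Rpower (- t) (alpha + 1) * xi_s).
        - exists (mkposreal 1 Rlt_0_1); intros t Ht.
          apply Rabs_lt_between' in Ht; simpl in Ht.
          unfold radius; rewrite Rabs_left by lra; reflexivity.
        - unfold Rpower; auto_derive; [lra |].
          replace (- -1) with 1 by lra.
          rewrite ln_1, Rmult_0_r, exp_0; field. }
      rewrite Hd in H.
      assert (HX : Rabs (scaled_X alpha V xi_s) < Cs xi_s).
      { rewrite <- Rabs_Ropp; unfold scaled_X.
        replace (- ((alpha + 1) * xi_s + V xi_s))
          with (- (alpha + 1) * xi_s - V xi_s) by ring; exact H. }
      apply Rabs_def2 in HX; nra. }
    assert (Hpos : exists b, xi_s < b /\ 0 < f b).
    { destruct (hbounded (-1) ltac:(lra)) as [_ [[M [N HM]] [_ [M' [N' HM']]]]].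
      (* The bounds [M] on the velocity and [M'] on the sound speed hold strictly beyond [N] and
         [N'], hence the [+ 1]. The last term makes [(alpha + 1) * b] exceed [M + M'], so that
         [scaled_X] exceeds [Cs] at [b]. *)
      set (b := Rmax (Rmax (xi_s + 1) (Rmax (N + 1) (N' + 1)))
                     ((M + M' + 1) / (alpha + 1))).
      assert (Hb1 : xi_s + 1 <= b)
        by (eapply Rle_trans; [apply Rmax_l | apply Rmax_l]).
      assert (HbN : N + 1 <= b).
      { eapply Rle_trans; [| apply Rmax_l].
        eapply Rle_trans; [apply Rmax_l | apply Rmax_r]. }
      assert (HbN' : N' + 1 <= b).
      { eapply Rle_trans; [| apply Rmax_l].
        eapply Rle_trans; [apply Rmax_r | apply Rmax_r]. }
      assert (Hb : M + M' + 1 <= (alpha + 1) * b).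
      { replace (M + M' + 1) with ((alpha + 1) * ((M + M' + 1) / (alpha + 1)))
          by (field; lra).
        apply Rmult_le_compat_l; [lra | apply Rmax_r]. }
      specialize (HM b ltac:(lra)); specialize (HM' b ltac:(lra)).
      destruct (Hc1 b ltac:(lra)) as [Hcb _].
      rewrite Hu1 in HM by lra.
      rewrite <- HCc in HM', Hcb by lra.
      apply Rabs_le_between in HM; apply Rabs_le_between in HM'.
      exists b; split; [lra |].
      rewrite Hf by lra.
      assert (HX : Cs b < scaled_X alpha V b) by (unfold scaled_X; lra).
      nra. }
    destruct Hpos as [b [Hb Hposb]].
    destruct (IVT f xi_s b Hcont Hb Hneg Hposb) as [z [[Hz _] Hfz]].
    (* The zero cannot be the left endpoint, where [f] is negative. *)
    assert (Hlt : xi_s < z).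
    { destruct Hz as [Hz | Hz]; [exact Hz |].
      rewrite <- Hz in Hfz; lra. }
    rewrite Hf in Hfz by lra.
    exists z; split; [exact Hlt |]; split; [lra |].
    rewrite Hfz; ring.
Qed.
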